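(* Let $\mathbb W_p:=M(W_p;x)$ for $p\ge1$, where $W_p$ is the caterpillar graph on $p$ nodes. These generating polynomials satisfy the recursion with initial conditions $$\mathbb W_1=1,\quad \mathbb W_2=1,\quad \mathbb W_3=1+x,\quad \mathbb W_4=1+2x,$$ and for $p\ge5$ $$\mathbb W_p=\begin{cases}\mathbb W_{p-1}+x\,\mathbb W_{p-2}&\text{for }p\text{ even},\\ (x+2)\mathbb W_{p-2}+(x^3-x^2+x-2)\mathbb W_{p-3}+(x^2+1)\mathbb W_{p-4}&\text{for }p\text{ odd}.\end{cases}$$
   Context: A DAG with skeleton $G$ (a finite simple undirected graph) is an acyclic orientation of all edges of $G$. An immorality in a DAG is an induced subgraph $i\to j\leftarrow k$ (so $i,k$ are nonadjacent). Two DAGs are Markov equivalent iff they have the same skeleton and the same set of immoralities; a Markov equivalence class (MEC) with skeleton $G$ is an equivalence class of DAGs with skeleton $G$, and all its members have the same immoralities. $m_k(G)$ is the number of MECs with skeleton $G$ having exactly $k$ immoralities, and $M(G;x)=\sum_{k\ge0}m_k(G)x^k$. $G_r(q_1,\ldots,q_r)$ is the graph obtained from the path with vertices $1,\ldots,r$ (in order) by attaching $q_i$ leaves to node $i$ for each $i$. The caterpillar graph $W_p$ (on $p$ nodes) is $W_p=G_{p/2}(1,1,\ldots,1)$ if $p$ is even and $W_p=G_{(p+1)/2}(1,1,\ldots,1,0)$ if $p$ is odd. *)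

(* Defs.v *)
From mathcomp Require Import all_boot all_order all_algebra.

Set Implicit Arguments.
Unset Strict Implicit.
Unset Printing Implicit Defensive.

Import GRing.Theory.

Record sgraph := SGraph {
  svertex :> finType;
  sedge : rel svertex;
  sedge_sym : symmetric sedge;
  sedge_irr : irreflexive sedge
}.

Section Digraphs.

Variable T : finType.
Implicit Types D : {set T * T}.

(* A digraph on T is its set of arcs: (i, j) \in D stands for i -> j. *)
Definition arc D : rel T := fun i j => (i, j) \in D.

(* No arc x -> y is closed up into a directed cycle by a directed path from y
   to x.  In particular there are no loops and no pairs of opposite arcs. *)
Definition acyclic D : bool :=
  [forall x, forall y, arc D x y ==> ~~ connect (arc D) y x].

Definition skeleton D : {set T * T} :=
  [set a | arc D a.1 a.2 || arc D a.2 a.1].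

(* The immorality i -> j <- k is recorded as (j, {i, k}), so that it is not
   counted twice under the exchange of i and k. *)
Definition immoralities D : {set T * {set T}} :=
  [set c | [exists i, exists k,
     [&& i != k, arc D i c.1, arc D k c.1,
         ~~ arc D i k, ~~ arc D k i & c.2 == [set i; k]]]].

Definition markov_equiv D1 D2 : bool :=
  (skeleton D1 == skeleton D2) && (immoralities D1 == immoralities D2).

Lemma markov_equiv_equivalence : equivalence_rel markov_equiv.
Proof.
move=> D1 D2 D3; rewrite /markov_equiv !eqxx; split=> //.
by case/andP=> /eqP-> /eqP->.
Qed.

End Digraphs.

Definition dags (G : sgraph) : {set {set G * G}} :=
  [set D : {set G * G} |
    acyclic D && (skeleton D == [set a : G * G | sedge a.1 a.2])].

Definition MECs (G : sgraph) : {set {set {set G * G}}} :=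
  equivalence_partition (@markov_equiv G) (dags G).

Lemma MEC_nonempty (G : sgraph) (C : {set {set G * G}}) :
  C \in MECs G -> C != set0.
Proof.
case/imsetP=> D DG ->; apply/set0Pn; exists D.
by rewrite inE DG /markov_equiv !eqxx.
Qed.

Lemma MEC_immoralities (G : sgraph) (C : {set {set G * G}}) D1 D2 :
  C \in MECs G -> D1 \in C -> D2 \in C -> immoralities D1 = immoralities D2.
Proof.
case/imsetP=> D _ ->; rewrite !inE.
by move=> /and3P[_ _ /eqP <-] /and3P[_ _ /eqP <-].
Qed.

Definition mec_count (G : sgraph) (k : nat) : nat :=
  #|[set C in MECs G | [forall D in C, #|immoralities D| == k]]|.

Local Open Scope ring_scope.

(* The sum over all k >= 0 is truncated at the number of candidate
   immoralities, beyond which mec_count vanishes: see coef_mec_poly. *)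
Definition mec_poly (G : sgraph) : {poly int} :=
  \poly_(k < #|{: G * {set G}}|.+1) (mec_count G k)%:R.

Lemma coef_mec_poly (G : sgraph) (k : nat) :
  (mec_poly G)`_k = (mec_count G k)%:R.
Proof.
rewrite coef_poly; case: ltnP => // lek.
suff -> : mec_count G k = 0%N by [].
apply/eqP; rewrite cards_eq0 -subset0; apply/subsetP=> C.
rewrite !inE => /andP[/MEC_nonempty/set0Pn[D DC] /forall_inP/(_ D DC)/eqP Dk].
by have := leq_trans lek (leq_trans (eq_leq (esym Dk)) (max_card _));
  rewrite ltnn.
Qed.

Local Close Scope ring_scope.

Section PathWithLeaves.

Variable q : seq nat.

(* inl i is the path node i (numbered from 0), and inr (Tagged _ l), with
   tag i, is the l-th leaf attached to i. *)
Definition pl_vertex : finType :=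
  ('I_(size q) + {i : 'I_(size q) & 'I_(nth 0 q i)})%type.

Definition pl_edge : rel pl_vertex := fun u v =>
  match u, v with
  | inl i, inl j => (i.+1 == j :> nat) || (j.+1 == i :> nat)
  | inl i, inr l | inr l, inl i => tag l == i
  | inr _, inr _ => false
  end.

Lemma pl_edge_sym : symmetric pl_edge.
Proof. by move=> [i|l] [j|l'] //=; rewrite orbC. Qed.

Lemma pl_edge_irr : irreflexive pl_edge.
Proof. by move=> [i|l] //=; rewrite orbb gtn_eqF. Qed.

(* The graph G_r(q_1, ..., q_r), where q = [:: q_1; ...; q_r]. *)
Definition path_leaves : sgraph := SGraph pl_edge_sym pl_edge_irr.

End PathWithLeaves.

Definition caterpillar (p : nat) : sgraph :=
  path_leaves (if odd p then rcons (nseq p./2 1) 0 else nseq p./2 1).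

Definition W (p : nat) : {poly int} := mec_poly (caterpillar p).

(* Main.v *)
Require Import Defs.
From mathcomp Require Import all_boot all_order all_algebra.
From mathcomp Require Import zify ring.

Import Defs.

Set Implicit Arguments.
Unset Strict Implicit.
Unset Printing Implicit Defensive.

Import GRing.Theory.

(** A Markov equivalence class with skeleton G is determined by its set of
    immoralities, so M(G; x) is the generating function of the immorality sets
    that acyclic orientations of G realise.  A caterpillar has no triangles,
    hence the immoralities at a vertex v are exactly the pairs of parents of v,
    and they amount to the parent set of v as soon as it has two elements; a
    smaller parent set leaves no trace.  Leaves never have two parents.  What is
    observed at a spine node is therefore its trimmed profile: the three bits
    telling whether its left neighbour, its right neighbour and its leaf are
    parents, erased when at most one of them is.  An orientation of a caterpillar
    is a free choice of a bit per edge (every edge is a bridge, so no directed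
    cycle can appear), and immorality sets correspond to the words of trimmed
    profiles along the spine that some choice of bits produces.

    Read from left to right, such words form a regular language: the only
    information passed from a node to the next one is the direction of the spine
    edge between them.  A word may come from several orientations, so words are
    counted through the subset construction, whose states are the sets of
    directions of the current spine edge compatible with the word read so far
    ([words], [wordsP]).  The word determines its path through the states, and
    each word is met once.  Lemma [mec_poly_path_leaves] turns M into the
    generating function [word_poly] of that language.

    Prepending a spine node with a leaf acts linearly on the vector of the
    polynomials [word_poly q S], indexed by the states S
    ([word_poly_cons]).  So a linear relation between the vectors of several
    spines survives when the same node is prepended to all of them, and both
    recursions follow by induction from their shortest instance
    ([word_poly_leaf_end], [word_poly_bare_end]); the latter is a polynomial
    identity for each of the four states. *)

(** * Markov equivalence classes as immorality sets *)

(** Markov equivalent DAGs of a given skeleton are those with equal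
    immoralities, so any invariant [code] that separates and is determined by
    immorality sets indexes the classes. *)
Lemma mec_poly_code (G : sgraph) (T : eqType) (code : {set G * G} -> T)
    (wt : T -> nat) (s : seq T) :
  uniq s ->
  (forall c, reflect (exists2 D, D \in dags G & code D = c) (c \in s)) ->
  {in dags G &, forall D1 D2,
     (immoralities D1 == immoralities D2) = (code D1 == code D2)} ->
  {in dags G, forall D, #|immoralities D| = wt (code D)} ->
  mec_poly G = (\sum_(c <- s) 'X^(wt c))%R.
Proof.
move=> uniq_s sP codeP wtP; apply/polyP=> k.
rewrite coef_mec_poly coef_sum.
under eq_bigr => c _ do rewrite coefXn.
pose cls c := [set D in dags G | code D == c].
have clsP D c : (D \in cls c) = (D \in dags G) && (code D == c).
  by rewrite in_set.
have clsE D : D \in dags G ->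
    [set D' in dags G | markov_equiv D D'] = cls (code D).
  move=> DG; apply/setP=> D'; rewrite clsP in_set; apply: andb_id2l => D'G.
  have skE D'' : D'' \in dags G -> skeleton D'' = [set a | sedge a.1 a.2].
    by rewrite in_set => /andP[_ /eqP].
  by rewrite /markov_equiv !skE // eqxx codeP // eq_sym.
have cls_inj : {in s &, injective cls}.
  move=> c1 c2 /sP[D DG <-] _ /setP/(_ D).
  by rewrite !clsP DG eqxx /= => /esym/eqP.
suff -> : mec_count G k = size [seq c <- s | wt c == k].
  rewrite size_filter -sum1_count big_mkcond /= natr_sum.
  by apply: eq_bigr => c _; rewrite eq_sym; case: eqP.
rewrite -(size_map cls) /mec_count.
have /card_uniqP <- : uniq [seq cls c | c <- s & wt c == k].
  rewrite map_inj_in_uniq ?filter_uniq // => c1 c2.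
  by rewrite !mem_filter => /andP[_ c1s] /andP[_ c2s]; apply: cls_inj.
apply: eq_card => C; rewrite in_set; apply/andP/mapP.
  case=> /imsetP[D DG ->]; rewrite (clsE D DG) => /forall_inP wtC.
  exists (code D) => //; rewrite mem_filter; apply/andP; split.
    by rewrite -(wtP D DG); apply: wtC; rewrite clsP DG eqxx.
  by apply/sP; exists D.
case=> c; rewrite mem_filter => /andP[/eqP wtc /sP[D DG Dc]] ->; split.
  by apply/imsetP; exists D; rewrite // clsE // Dc.
apply/forall_inP=> D'; rewrite clsP => /andP[D'G /eqP D'c].
by rewrite wtP // D'c wtc.
Qed.

(** * Immoralities as pairs of parents *)

Definition parents (T : finType) (D : {set T * T}) (v : T) : {set T} :=
  [set u | arc D u v].

Definition triangle_free (G : sgraph) : Prop :=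
  forall u v w : G, sedge u v -> sedge v w -> ~~ sedge u w.

Lemma arc_edge (G : sgraph) (D : {set G * G}) u v :
  D \in dags G -> arc D u v || arc D v u = sedge u v.
Proof. by rewrite inE => /andP[_ /eqP/setP/(_ (u, v))]; rewrite !inE. Qed.

Lemma arcNsym (G : sgraph) (D : {set G * G}) u v :
  D \in dags G -> arc D u v -> ~~ arc D v u.
Proof.
rewrite inE => /andP[/forallP/(_ u)/forallP/(_ v)/implyP acD _] /acD.
by apply: contra; apply: connect1.
Qed.

(** Two parents of the same vertex cannot be adjacent when there are no
    triangles, which makes the nonadjacency condition automatic. *)
Lemma immoralitiesE (G : sgraph) (D : {set G * G}) :
  triangle_free G -> D \in dags G ->
  immoralities D =
    [set c : G * {set G} | (c.2 \subset parents D c.1) && (#|c.2| == 2)].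
Proof.
move=> tfG DG; apply/setP=> -[j A]; rewrite !inE /=; apply/idP/idP.
  case/existsP=> i /existsP[k /and5P[ik Dij Dkj _ /andP[_ /eqP->]]].
  by rewrite cards2 ik subUset !sub1set !inE Dij Dkj.
case/andP=> sub /cards2P[i [k [ik A_ik]]].
move: sub; rewrite A_ik subUset !sub1set !inE => /andP[Dij Dkj].
apply/existsP; exists i; apply/existsP; exists k; rewrite ik Dij Dkj eqxx andbT.
rewrite /= -negb_or arc_edge //; apply: (tfG i j k).
  by rewrite -(arc_edge _ _ DG) Dij.
by rewrite -(arc_edge _ _ DG) Dkj orbT.
Qed.

Lemma card_immoralities (G : sgraph) (D : {set G * G}) :
  triangle_free G -> D \in dags G ->
  #|immoralities D| = \sum_v 'C(#|parents D v|, 2).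
Proof.
move=> tfG DG; rewrite immoralitiesE //.
under eq_bigr => v _ do rewrite -cards_draws -sum1_card.
rewrite pair_big_dep /= -sum1_card; apply: eq_bigl => -[v A].
by rewrite !inE.
Qed.

(** A set with at least two elements is the union of its pairs, so the
    immoralities recover every parent set of that size. *)
Lemma immoralities_eqP (G : sgraph) (D1 D2 : {set G * G}) :
  triangle_free G -> D1 \in dags G -> D2 \in dags G ->
  immoralities D1 = immoralities D2 <->
  forall v, (1 < #|parents D1 v|) || (1 < #|parents D2 v|) ->
    parents D1 v = parents D2 v.
Proof.
move=> tfG DG1 DG2; rewrite !immoralitiesE //; split=> [eqI v | eqpa]; last first.
  apply/setP=> -[v A]; rewrite !inE /=; apply/andP/andP=> -[sA cA];
    split=> //; have := subset_leq_card sA; rewrite (eqP cA) => lt1.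
    by rewrite -eqpa // lt1.
  by rewrite eqpa // lt1 orbT.
have sub (D D' : {set G * G}) :
    (forall A : {set G}, (A \subset parents D v) && (#|A| == 2) ->
               (A \subset parents D' v) && (#|A| == 2)) ->
    1 < #|parents D v| -> parents D v \subset parents D' v.
  move=> DD' gt1; apply/subsetP=> u Du.
  have /card_gt0P[w] : 0 < #|parents D v :\ u|.
    by move: gt1; rewrite (cardsD1 u) Du.
  rewrite in_setD1 => /andP[wu Dw].
  have := DD' [set u; w].
  rewrite !subUset !sub1set Du Dw cards2 [u == w]eq_sym wu /= => /(_ isT).
  by case/andP=> /andP[].
have P12 (A : {set G}) : ((A \subset parents D1 v) && (#|A| == 2)) =
             ((A \subset parents D2 v) && (#|A| == 2)).
  by move/setP/(_ (v, A)): eqI; rewrite !inE.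
have s12 : 1 < #|parents D1 v| -> parents D1 v \subset parents D2 v.
  by apply: sub => A; rewrite P12.
have s21 : 1 < #|parents D2 v| -> parents D2 v \subset parents D1 v.
  by apply: sub => A; rewrite P12.
case/orP=> gt1; apply/eqP; rewrite eqEsubset.
  by rewrite s12 // s21 // (leq_trans gt1) // subset_leq_card // s12.
by rewrite s21 // s12 // (leq_trans gt1) // subset_leq_card // s21.
Qed.

(** The set [A] is a cut that the arc enters and that no arc leaves: a walk that
    has taken the arc can never come back.  In an orientation of a tree such a
    cut is one side of the bridge. *)
Lemma acyclic_bridges (T : finType) (D : {set T * T}) :
  (forall u v, arc D u v -> exists A : {set T},
     [/\ u \notin A, v \in A & forall x y, arc D x y -> x \in A -> y \in A]) ->
  acyclic D.
Proof.
move=> cutD; apply/forallP=> u; apply/forallP=> v; apply/implyP=> /cutD[A].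
case=> uA vA clA; apply: contra uA => /connectP[p].
elim: p v vA => [|w p IHp] v vA /=; first by move=> _ ->.
by case/andP=> vw; apply: IHp; apply: clA vw vA.
Qed.

(** * Words of trimmed profiles *)

(** The bits stand for the left neighbour, the right neighbour and the leaf of a
    spine node, in this order; a bit is set when that vertex is a parent. *)
Definition profile := (bool * bool * bool)%type.

Definition indeg (a : profile) : nat := a.1.1 + a.1.2 + a.2.

Definition trim (a : profile) : profile :=
  if 1 < indeg a then a else (false, false, false).

Lemma bin_indeg_trim a : 'C(indeg (trim a), 2) = 'C(indeg a, 2).
Proof. by move: a => [[[] []] []]. Qed.

(** The right-hand side is the shape in which parent sets are compared by the
    immoralities, see [immoralities_eqP]. *)
Lemma trim_eqP a b :
  trim a = trim b <-> ((1 < indeg a) || (1 < indeg b) -> a = b).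
Proof.
by move: a b => [[[] []] []] [[[] []] []]; split=> //= H; have := H isT.
Qed.

(** The state [S] is a set of directions of a spine edge: a direction is [true]
    when the edge points to the right, and [S] lists the memberships of [false]
    and of [true]. *)
Definition possible (S : bool * bool) (d : bool) := if d then S.2 else S.1.

(** Here [h] is the number of leaves of the node, [d] and [d'] are the directions
    of its left and right spine edges, and [l] says whether a leaf is a parent;
    the bound [l <= h] forbids it when there is no leaf. *)
Definition step (h : nat) (d d' : bool) (a : profile) : bool :=
  has (fun l : bool => (l <= h) && (a == trim (d, ~~ d', l))) [:: false; true].

Definition next_state (h : nat) (S : bool * bool) (a : profile) : bool * bool :=
  let can d' := has (fun d => possible S d && step h d d' a) [:: false; true] in
  (can false, can true).

(** Each value of [trim] occurs once in this list: that is what makes the words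
    enumerated below pairwise distinct. *)
Definition trimmed : seq profile :=
  [:: (false, false, false); (true, true, false); (true, false, true);
      (false, true, true); (true, true, true)].

(** The final test on [S.2] treats the missing right neighbour of the last node
    as an edge pointing to the right, for this makes it a non-parent.
    Symmetrically, reading starts in the state [(true, false)], where the edge
    missing on the left points to the left. *)
Fixpoint words (q : seq nat) (S : bool * bool) : seq (seq profile) :=
  if q is h :: q' then
    [seq a :: w | a <- trimmed, w <- words q' (next_state h S a)]
  else if S.2 then [:: [::]] else [::].

Lemma words_cons h q S :
  words (h :: q) S = [seq a :: w | a <- trimmed, w <- words q (next_state h S a)].
Proof. by []. Qed.

Lemma words_uniq q S : uniq (words q S).
Proof.
elim: q S => [|h q IHq] S; first by rewrite /=; case: S.2.
rewrite words_cons.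
apply: (@allpairs_uniq_dep profile (fun=> seq profile : eqType) _ cons) => //.
move=> -[a w] [b v] _ _ /=; by case=> -> ->.
Qed.

Lemma stepP h d d' a :
  reflect (exists2 l : bool, l <= h & a = trim (d, ~~ d', l)) (step h d d' a).
Proof.
apply: (iffP hasP) => [[l _ /andP[lh /eqP ->]] | [l lh ->]]; exists l => //.
  by case: l {lh}.
by rewrite lh eqxx.
Qed.

Lemma next_stateP h S a d' :
  reflect (exists2 d, possible S d & step h d d' a) (possible (next_state h S a) d').
Proof.
have -> : possible (next_state h S a) d' =
    has (fun d => possible S d && step h d d' a) [:: false; true].
  by case: d'.
apply: (iffP hasP) => [[d _ /andP[]] | [d Sd st]]; exists d => //.
  by case: d {Sd st}.
by rewrite Sd st.
Qed.

(** Correctness of the subset construction: [d i] is the direction of the spine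
    edge on the left of node [i], and [l i] the bit of its leaf. *)
Lemma wordsP q S w :
  reflect (exists d l : nat -> bool,
             [/\ possible S (d 0), d (size q),
                 forall i, i < size q -> l i <= nth 0 q i
               & w = mkseq (fun i => trim (d i, ~~ d i.+1, l i)) (size q)])
          (w \in words q S).
Proof.
elim: q S w => [|h q IHq] S w.
  rewrite /=; case: ifP => S2;
    [rewrite mem_seq1; apply: (iffP eqP) | apply: (iffP idP)] => //.
  - by move=> ->; exists xpredT, xpredT; split.
  - by case=> d [l [_ _ _ ->]].
  - by case=> d [l [Sd0 d0]]; move: Sd0; rewrite d0 /= S2.
rewrite words_cons; apply: (iffP allpairsPdep).
  case=> a [v [_ /IHq[d [l [/next_stateP[d0 Sd0 /stepP[l0 l0h aE]] dq lq vE]]] ->]].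
  exists (fun i => if i is i'.+1 then d i' else d0).
  exists (fun i => if i is i'.+1 then l i' else l0).
  split=> //; first by case.
  by rewrite /mkseq /= -[1]addn0 iotaDl -map_comp aE vE.
case=> d [l [Sd0 dq lq ->]].
exists (trim (d 0, ~~ d 1, l 0)).
exists (mkseq (fun i => trim (d i.+1, ~~ d i.+2, l i.+1)) (size q)).
split.
- by case: (d 0) (d 1) (l 0) => [] [] [].
- apply/IHq; exists (fun i => d i.+1), (fun i => l i.+1); split=> //.
    apply/next_stateP; exists (d 0) => //; apply/stepP; exists (l 0) => //.
    exact: (lq 0).
  by move=> i; apply: (lq i.+1).
- by rewrite /mkseq /= -[1]addn0 iotaDl -map_comp.
Qed.

(** * The word of an orientation *)

(** The position of a neighbour [u] of the spine node [i] in its profile. *)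
Definition slot (q : seq nat) (i : 'I_(size q)) (u : path_leaves q) : 'I_3 :=
  match u with
  | inl j => if j < i then @Ordinal 3 0 isT else @Ordinal 3 1 isT
  | inr _ => @Ordinal 3 2 isT
  end.

Definition slots (q : seq nat) (D : {set path_leaves q * path_leaves q})
    (i : 'I_(size q)) : {set 'I_3} := slot i @: parents D (inl i).

Definition profile_of (A : {set 'I_3}) : profile :=
  (@Ordinal 3 0 isT \in A, @Ordinal 3 1 isT \in A, @Ordinal 3 2 isT \in A).

Definition word (q : seq nat) (D : {set path_leaves q * path_leaves q}) :
    seq profile :=
  [seq trim (profile_of (slots D i)) | i <- enum 'I_(size q)].

Lemma profile_of_inj : injective profile_of.
Proof.
move=> A B [e0 e1 e2]; apply/setP=> -[[|[|[|//]]] lt3].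
- by rewrite (bool_irrelevance lt3 isT).
- by rewrite (bool_irrelevance lt3 isT).
- by rewrite (bool_irrelevance lt3 isT).
Qed.

Lemma indeg_profile_of A : indeg (profile_of A) = #|A|.
Proof.
rewrite -sum1_card big_mkcond !big_ord_recl big_ord0 /indeg /=.
rewrite -!addnA addn0; congr (_ + (_ + _)).
- by rewrite (_ : Ordinal _ = ord0); [case: ifP | apply: val_inj].
- by rewrite (_ : Ordinal _ = lift ord0 ord0); [case: ifP | apply: val_inj].
- rewrite (_ : Ordinal _ = lift ord0 (lift ord0 ord0)); first by case: ifP.
  exact: val_inj.
Qed.

(** With at most one leaf per spine node the neighbours of a node occupy distinct
    positions, so profiles are faithful images of parent sets. *)
Lemma slot_inj (q : seq nat) (i : 'I_(size q)) :
  all (leq^~ 1) q ->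
  {in [pred u : path_leaves q | sedge u (inl i)] &, injective (slot i)}.
Proof.
move=> q1 [j|[j l]] [k|[k m]]; rewrite !inE /=; [| by case: ifP | by case: ifP |].
  move=> ej ek; case: ltnP => ji; case: ltnP => ki // _; congr inl;
    by apply: val_inj => /=; lia.
move=> /eqP ji /eqP ki _; subst j k; congr (inr (existT _ _ _)).
have := allP q1 _ (mem_nth 0 (ltn_ord i)) => /= qi1.
by apply: val_inj => /=; have := ltn_ord l; have := ltn_ord m; lia.
Qed.

Lemma parents_neighbours (G : sgraph) (D : {set G * G}) u v :
  D \in dags G -> u \in parents D v -> sedge u v.
Proof. by move=> DG; rewrite inE -(arc_edge _ _ DG) => ->. Qed.

Lemma indeg_slots q (D : {set path_leaves q * path_leaves q}) i :
  all (leq^~ 1) q -> D \in dags (path_leaves q) ->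
  indeg (profile_of (slots D i)) = #|parents D (inl i)|.
Proof.
move=> q1 DG; rewrite indeg_profile_of card_in_imset // => u v uD vD.
by apply: slot_inj => //; rewrite inE (parents_neighbours DG).
Qed.

Lemma slots_parents q (D1 D2 : {set path_leaves q * path_leaves q}) i :
  all (leq^~ 1) q ->
  D1 \in dags (path_leaves q) -> D2 \in dags (path_leaves q) ->
  profile_of (slots D1 i) = profile_of (slots D2 i) <->
  parents D1 (inl i) = parents D2 (inl i).
Proof.
move=> q1; wlog suff sub : D1 D2 / D1 \in dags (path_leaves q) ->
    D2 \in dags (path_leaves q) ->
    slots D1 i = slots D2 i -> parents D1 (inl i) \subset parents D2 (inl i).
  move=> DG1 DG2; split=> [/profile_of_inj eqS | eqP]; last by rewrite /slots eqP.
  by apply/eqP; rewrite eqEsubset !sub.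
move=> DG1 DG2 eqS; apply/subsetP=> u uD1.
have : slot i u \in slots D2 i by rewrite -eqS; apply: imset_f.
case/imsetP=> v vD2 /slot_inj -> //; rewrite inE.
  exact: parents_neighbours uD1.
exact: parents_neighbours vD2.
Qed.

Lemma leaf_parents q (D : {set path_leaves q * path_leaves q}) l :
  D \in dags (path_leaves q) -> #|parents D (inr l)| <= 1.
Proof.
move=> DG; rewrite -(cards1 (inl (tag l) : path_leaves q)).
apply/subset_leq_card/subsetP=> u /(parents_neighbours DG).
by rewrite inE; case: u => [i|m] //= /eqP ->.
Qed.

Lemma path_leaves_triangle_free q : triangle_free (path_leaves q).
Proof. by move=> [i|l] [j|m] [k|n] //=; rewrite -?val_eqE /=; lia. Qed.

Definition weight (w : seq profile) : nat := \sum_(a <- w) 'C(indeg a, 2).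

(** Only parent sets with two elements or more are visible in the immoralities,
    and those are the ones that [trim] keeps; leaves have a single neighbour. *)
Lemma immoralities_word q :
  all (leq^~ 1) q ->
  {in dags (path_leaves q) &, forall D1 D2,
    (immoralities D1 == immoralities D2) = (word D1 == word D2)}.
Proof.
move=> q1 D1 D2 DG1 DG2; have tf := @path_leaves_triangle_free q.
apply/eqP/eqP=> [/(immoralities_eqP tf DG1 DG2) eqI | /eq_in_map eqw].
  apply: eq_map => i; apply/trim_eqP; rewrite !indeg_slots // => /eqI.
  by move/(slots_parents i q1 DG1 DG2).
apply/(immoralities_eqP tf DG1 DG2) => -[i|l] gt1; last first.
  by move: gt1; rewrite !ltnNge !leaf_parents.
apply/(slots_parents i q1 DG1 DG2).
have /trim_eqP := eqw i (mem_enum _ i).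
by rewrite !indeg_slots //; apply.
Qed.

Lemma card_immoralities_word q :
  all (leq^~ 1) q ->
  {in dags (path_leaves q), forall D, #|immoralities D| = weight (word D)}.
Proof.
move=> q1 D DG; rewrite card_immoralities //; last exact: path_leaves_triangle_free.
rewrite big_sumType /= [X in _ + X]big1 ?addn0; last first.
  by move=> l _; apply: bin_small; rewrite ltnS leaf_parents.
rewrite /weight big_map big_enum /=; apply: eq_bigr => i _.
by rewrite bin_indeg_trim indeg_slots.
Qed.

(** * Orientations realise all the accepted words *)

(** The direction of the edge between the spine nodes [n.-1] and [n], with the
    conventions of [words] at both ends: [false] at [0] and [true] at [size q]. *)
Definition rightward (q : seq nat) (D : {set path_leaves q * path_leaves q})
    (n : nat) : bool :=
  (size q <= n) || [exists u : 'I_(size q), exists v : 'I_(size q),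
    [&& u.+1 == n, v == n :> nat & arc D (inl u) (inl v)]].

Definition leaf_in (q : seq nat) (D : {set path_leaves q * path_leaves q})
    (n : nat) : bool :=
  [exists m : {i : 'I_(size q) & 'I_(nth 0 q i)},
    (tag m == n :> nat) && arc D (inr m) (inl (tag m))].

(** A right neighbour is a parent exactly when the edge to it does not point to
    the right, because each edge has one and only one direction. *)
Lemma profile_of_slots (q : seq nat) (D : {set path_leaves q * path_leaves q})
    (i : 'I_(size q)) :
  D \in dags (path_leaves q) ->
  profile_of (slots D i) = (rightward D i, ~~ rightward D i.+1, leaf_in D i).
Proof.
move=> DG; have edge u : u \in parents D (inl i) -> sedge u (inl i).
  exact: parents_neighbours.
rewrite /profile_of; congr (_, _, _).
- rewrite /rightward leqNgt ltn_ord /=; apply/imsetP/existsP.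
    case=> -[j|//] jD /=; case: ltnP => // ji _; exists j.
    have /= ej := edge _ jD; move: jD; rewrite inE => jD.
    by apply/existsP; exists i; rewrite jD eqxx !andbT; lia.
  case=> j /existsP[k /and3P[ji /eqP ki arc_jk]]; exists (inl j).
    by rewrite inE -[i](val_inj ki).
  by rewrite /= -(eqP ji) ltnSn.
- apply/imsetP/idP.
    case=> -[j|//] jD /=; case: ltnP => // ij _.
    have /= ej := edge _ jD; move: jD; rewrite inE => jD.
    have {ej} ji : i.+1 = j by lia.
    rewrite /rightward ji leqNgt ltn_ord /=; apply/existsP=> -[i' /existsP[j']].
    case/and3P=> /eqP ii' /eqP jj'.
    have -> : i' = i by apply: val_inj => /=; lia.
    have -> : j' = j by apply: val_inj.
    by apply/negP; apply: (arcNsym DG).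
  rewrite negb_or -ltnNge => /andP[ir]; pose j := Ordinal ir.
  move/existsPn/(_ i)/existsPn/(_ j); rewrite /= !eqxx /= => Nij.
  exists (inl j); last by rewrite /= ltnNge leqnSn.
  have := @arc_edge (path_leaves q) D (inl i) (inl j) DG.
  by rewrite inE (negbTE Nij) /= eqxx.
- apply/imsetP/existsP.
    case=> -[j|m] mD /=; first by case: ifP.
    have /= /eqP mi := edge _ mD; move: mD; rewrite inE => mD _.
    by exists m; rewrite mi eqxx.
  case=> m /andP[/eqP/val_inj mi mD]; exists (inr m) => //.
  by rewrite inE -mi.
Qed.

Lemma wordE (q : seq nat) (D : {set path_leaves q * path_leaves q}) :
  D \in dags (path_leaves q) ->
  word D = mkseq
    (fun i => trim (rightward D i, ~~ rightward D i.+1, leaf_in D i)) (size q).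
Proof.
move=> DG; rewrite /mkseq -val_enum_ord -map_comp; apply: eq_map => i /=.
by rewrite profile_of_slots.
Qed.

(** The orientation prescribed by the directions [d] of the spine edges and the
    bits [l] of the leaves, in the sense of [wordsP]. *)
Definition orient (q : seq nat) (d l : nat -> bool) :
    {set path_leaves q * path_leaves q} :=
  [set a : path_leaves q * path_leaves q | match a.1, a.2 with
    | inl i, inl j => (i.+1 == j) && d j || (j.+1 == i) && ~~ d i
    | inl i, inr m => (tag m == i) && ~~ l i
    | inr m, inl i => (tag m == i) && l i
    | inr _, inr _ => false
    end].

(** A spine edge separates the spine nodes on its left, with their leaves, from
    those on its right, and a leaf edge separates the leaf from all the rest:
    these are the cuts that exclude directed cycles. *)
Lemma orient_dag q d l : orient q d l \in dags (path_leaves q).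
Proof.
rewrite inE; apply/andP; split; last first.
  apply/eqP/setP=> -[[i|m] [j|n]]; rewrite !inE /arc !inE //=.
  - by case: (d i) (d j) => [] []; lia.
  - by case: (l i); rewrite ?andbT ?andbF ?orbF.
  - by case: (l j); rewrite ?andbT ?andbF ?orbF.
apply: acyclic_bridges => u v.
pose pos (w : path_leaves q) : nat := match w with inl i => i | inr m => tag m end.
rewrite /arc inE /=; case: u v => [i|m] [j|n] //=.
- case/orP=> /andP[/eqP ij dij].
    exists [set w | j <= pos w]; split; rewrite ?inE /= -?ij ?ltnn //.
    move=> [x|x] [y|y]; rewrite /arc !inE //=; try by case/andP=> /eqP->.
    case/orP=> /andP[/eqP xy dxy] jx; first by lia.
    case: (ltngtP i y) => // [yi|iy]; first by lia.
    by move: dij dxy; rewrite -ij -xy iy => ->.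
  exists [set w | pos w <= j]; split; rewrite ?inE /= -?ij ?ltnn //.
  move=> [x|x] [y|y]; rewrite /arc !inE //=; try by case/andP=> /eqP->.
  case/orP=> /andP[/eqP xy dxy] xj; last by lia.
  case: (ltngtP y i) => [yi|iy|yi]; [by lia | by lia |].
  by move: dij dxy; rewrite -yi => /negbTE->.
- case/andP=> /eqP mi li; exists [set inr n]; rewrite !inE eqxx; split=> //.
  move=> x y; rewrite !inE => + /eqP xn; rewrite {x}xn /=.
  by case: y => [y|//] /andP[/eqP <-]; rewrite mi (negbTE li).
- case/andP=> /eqP mj lj; exists [set~ inr m]; rewrite !inE eqxx; split=> //.
  move=> x y; rewrite !inE => + _; apply: contraL => /eqP->.
  by case: x => [x|//] /=; rewrite mj; apply/andP=> -[/eqP <-]; rewrite lj.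
Qed.

Lemma word_orient (q : seq nat) (d l : nat -> bool) :
  ~~ d 0 -> d (size q) ->
  (forall i, i < size q -> l i <= nth 0 q i) ->
  word (orient q d l) =
  mkseq (fun i => trim (d i, ~~ d i.+1, l i)) (size q).
Proof.
move=> d0 dq lq; rewrite wordE ?orient_dag //.
have dE n : n <= size q -> rightward (orient q d l) n = d n.
  rewrite /rightward leq_eqVlt => /predU1P[->|nq]; first by rewrite leqnn dq.
  rewrite leqNgt nq /=; apply/existsP/idP.
    case=> u /existsP[v /and3P[/eqP <- /eqP vu]]; rewrite /arc inE /= vu eqxx.
    by case/orP=> // /andP[]; lia.
  case: n nq => [|n] nq dn; first by rewrite dn in d0.
  exists (Ordinal (ltnW nq)); apply/existsP; exists (Ordinal nq).
  by rewrite /arc inE /= !eqxx dn.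
have lE n : n < size q -> leaf_in (orient q d l) n = l n.
  move=> nq; apply/existsP/idP.
    by case=> m /andP[/eqP <-]; rewrite /arc inE /= eqxx.
  move=> ln; have := lq n nq; rewrite ln => qn.
  exists (existT _ (Ordinal nq) (Ordinal qn)).
  by rewrite /arc inE /= !eqxx.
apply/eq_in_map => i; rewrite mem_iota add0n => /andP[_ iq].
by rewrite !dE ?lE // ltnW.
Qed.

Lemma word_dagsP (q : seq nat) (w : seq profile) :
  0 < size q ->
  reflect (exists2 D, D \in dags (path_leaves q) & word D = w)
          (w \in words q (true, false)).
Proof.
move=> q_gt0; apply: (iffP (wordsP _ _ _)).
  case=> d [l [d0 dq lq ->]]; exists (orient q d l); first exact: orient_dag.
  by apply: word_orient => //; case: (d 0) d0.
case=> D DG <-; exists (rightward D), (leaf_in D); split.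
- rewrite /rightward leqNgt q_gt0 /=; case: existsP => // -[u /existsP[v]].
  by [].
- by rewrite /rightward leqnn.
- move=> i iq; case li: (leaf_in D i) => //.
  case/existsP: li => -[j m] /andP[/eqP <- _] /=.
  exact: leq_ltn_trans (ltn_ord m).
- exact: wordE.
Qed.

(** * Generating functions *)

Local Open Scope ring_scope.

Definition word_poly (q : seq nat) (S : bool * bool) : {poly int} :=
  \sum_(w <- words q S) 'X^(weight w).

Lemma mec_poly_path_leaves (q : seq nat) :
  (0 < size q)%N -> all (leq^~ 1)%N q ->
  mec_poly (path_leaves q) = word_poly q (true, false).
Proof.
move=> q_gt0 q1; apply: mec_poly_code (words_uniq _ _) _ _ _.
- by move=> w; apply: word_dagsP.
- exact: immoralities_word.
- exact: card_immoralities_word.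
Qed.

(** The first letter alone determines the next state, so that the coefficients
    of this sum do not depend on [q]. *)
Lemma word_poly_cons h q S :
  word_poly (h :: q) S =
  \sum_(a <- trimmed) 'X^('C(indeg a, 2)) * word_poly q (next_state h S a).
Proof.
rewrite /word_poly words_cons big_allpairs_dep /=; apply: eq_bigr => a _.
rewrite big_distrr /=; apply: eq_bigr => w _.
by rewrite /weight big_cons exprD.
Qed.

(** No direction of the next edge is compatible with an empty set of directions
    of the current one. *)
Lemma word_poly_empty q : word_poly q (false, false) = 0.
Proof.
elim: q => [|h q IHq]; first by rewrite /word_poly big_nil.
by rewrite word_poly_cons big1 // => a _; rewrite [next_state _ _ _]/= IHq mulr0.
Qed.

(* The transitions and the weights of the five letters are closed terms, which
   are evaluated before the sum is simplified. *)
Ltac expand_word_poly :=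
  rewrite word_poly_cons !big_cons big_nil;
  repeat match goal with
  | |- context [next_state ?h ?S ?a] =>
      let v := eval compute in (next_state h S a) in change (next_state h S a) with v
  | |- context [binomial (indeg ?a) 2] =>
      let v := eval compute in (binomial (indeg a) 2) in
      change (binomial (indeg a) 2) with v
  end; rewrite ?word_poly_empty.

(** The next three lemmas are the rows of the transfer matrix of a spine node
    with one leaf: [(false, true)] stands for a left edge forced to point to the
    right, [(true, false)] for one forced to point to the left, and
    [(true, true)] for one whose direction the word leaves open. *)
Lemma word_poly_right q :
  word_poly (1%N :: q) (false, true) =
    (1 + 'X) * word_poly q (false, true)
    + ('X + 'X^3) * word_poly q (true, false).
Proof. by expand_word_poly; ring. Qed.

Lemma word_poly_left q :
  word_poly (1%N :: q) (true, false) =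
    word_poly q (true, true) + 'X * word_poly q (true, false).
Proof. by expand_word_poly; ring. Qed.

Lemma word_poly_both q :
  word_poly (1%N :: q) (true, true) =
    word_poly q (true, true) + 'X * word_poly q (false, true)
    + (2%:R * 'X + 'X^3) * word_poly q (true, false).
Proof. by expand_word_poly; ring. Qed.

Lemma word_poly_nil S : word_poly [::] S = S.2%:R.
Proof.
by rewrite /word_poly /=; case: S.2; rewrite (big_nil, big_seq1) ?/weight ?big_nil.
Qed.

Lemma word_poly_bare S :
  word_poly [:: 0%N] S = (S.1 || S.2)%:R.
Proof.
by case: S => [[] []]; expand_word_poly; rewrite ?word_poly_nil /=; ring.
Qed.

(** On [nseq r 1], prepending a node applies the same linear map to the three
    terms, so that only the case [r = 0] needs a computation. *)
Lemma word_poly_leaf_end r S :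
  word_poly (nseq r.+1 1%N) S =
    word_poly (rcons (nseq r 1%N) 0%N) S + 'X * word_poly (nseq r 1%N) S.
Proof.
elim: r S => [|r IHr] S.
  rewrite /= word_poly_bare word_poly_nil.
  by case: S => [[] []]; rewrite ?(word_poly_right, word_poly_left,
    word_poly_both, word_poly_empty) ?word_poly_nil /=; ring.
rewrite [nseq r.+2 _]/= [rcons _ _]/= ![in RHS]word_poly_cons word_poly_cons.
rewrite big_distrr -big_split /=; apply: eq_bigr => a _.
by rewrite (IHr (next_state 1 S a)); ring.
Qed.

(** By linearity this relation is also inherited from [r = 0], where it is an
    identity between polynomials of degree at most four in each state. *)
Lemma word_poly_bare_end r S :
  word_poly (rcons (nseq r.+2 1%N) 0%N) S =
    ('X + 2%:R) * word_poly (rcons (nseq r.+1 1%N) 0%N) S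
    + ('X^3 - 'X^2 + 'X - 2%:R) * word_poly (nseq r.+1 1%N) S
    + ('X^2 + 1) * word_poly (rcons (nseq r 1%N) 0%N) S.
Proof.
elim: r S => [|r IHr] S.
  by case: S => [[] []]; rewrite /= ?(word_poly_right, word_poly_left,
    word_poly_both, word_poly_empty) ?word_poly_bare ?word_poly_nil /=; ring.
rewrite [rcons (nseq r.+3 _) _]/= [rcons (nseq r.+2 _) _]/=.
rewrite [nseq r.+2 _]/= [rcons (nseq r.+1 _) _]/= !word_poly_cons !big_distrr.
rewrite -!big_split /=; apply: eq_bigr => a _.
by rewrite (IHr (next_state 1 S a)); ring.
Qed.

(** * Caterpillars *)

Lemma W_even r : W r.+1.*2 = word_poly (nseq r.+1 1%N) (true, false).
Proof.
rewrite /W /caterpillar odd_double doubleK mec_poly_path_leaves //.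
by rewrite all_nseq orbT.
Qed.

Lemma W_odd r : W r.*2.+1 = word_poly (rcons (nseq r 1%N) 0%N) (true, false).
Proof.
rewrite /W /caterpillar /= odd_double uphalf_double mec_poly_path_leaves //.
  by rewrite size_rcons.
by rewrite all_rcons all_nseq orbT.
Qed.

Theorem theorem4p3 :
  [/\ W 1 = 1, W 2 = 1, W 3 = 1 + 'X, W 4 = 1 + 2%:R *: 'X &
      forall p : nat, (5 <= p)%N ->
        W p = if ~~ odd p then W (p - 1) + 'X * W (p - 2)
              else ('X + 2%:R) * W (p - 2)
                   + ('X^3 - 'X^2 + 'X - 2%:R) * W (p - 3)
                   + ('X^2 + 1) * W (p - 4)].
Proof.
split.
- by rewrite (W_odd 0) word_poly_bare.
- by rewrite (W_even 0) word_poly_left !word_poly_nil /=; ring.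
- by rewrite (W_odd 1) word_poly_left !word_poly_bare /=; ring.
- rewrite (W_even 1) !(word_poly_left, word_poly_both) !word_poly_nil /=.
  by rewrite scaler_nat; ring.
move=> p p5; case: ifPn => [even_p | /negPn odd_p].
  have [r pE] : exists r, p = r.+2.*2 by exists p./2.-2; lia.
  have -> : (p - 1 = r.+1.*2.+1)%N by lia.
  have -> : (p - 2 = r.+1.*2)%N by lia.
  by rewrite pE !W_even W_odd word_poly_leaf_end.
have [r pE] : exists r, p = r.+2.*2.+1 by exists p./2.-2; lia.
have -> : (p - 2 = r.+1.*2.+1)%N by lia.
have -> : (p - 3 = r.+1.*2)%N by lia.
have -> : (p - 4 = r.*2.+1)%N by lia.
by rewrite pE W_even !W_odd word_poly_bare_end.
Qed.
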